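(* Let $n\ge 1$ and let $X\sim\mathcal N(0,\mathrm I_{n\times n})$ be the standard Gaussian vector in $\mathbb R^n$. The extra factor $(1+|\nabla f|)^{-1}$ in the inequality $$\log \mathbb E\, e^{f(X)-\mathbb E f(X)}\le 10\,\mathbb E\left[e^{\frac12|\nabla f(X)|^2}(1+|\nabla f(X)|)^{-1}\right]$$ is the best possible in the sense that there is a smooth function $f:\mathbb R^n\to\mathbb R$ with $\mathbb E\, e^{f(X)}=\infty$ but $$\mathbb E\left[e^{\frac12|\nabla f(X)|^2}\,(1+|\nabla f(X)|)^{-c}\right]<\infty\quad\text{for all } c>1.$$
   Context: Here $|\nabla f|$ is the Euclidean norm of the gradient of $f$. The displayed inequality with the factor $(1+|\nabla f|)^{-1}$ holds for every $n\ge 1$ and all $f\in C_0^\infty(\mathbb R^n)$ (smooth, compactly supported functions). *)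

(* Defs.v *)
From HB Require Import structures.
From mathcomp Require Import all_boot all_order all_algebra.
From mathcomp Require Import all_classical all_reals all_analysis.

Set Implicit Arguments.
Unset Strict Implicit.
Unset Printing Implicit Defensive.

Import Order.TTheory GRing.Theory Num.Theory.
Import numFieldNormedType.Exports.

Local Open Scope classical_set_scope.
Local Open Scope ring_scope.

Definition partial_deriv (R : realType) (n : nat) (i : 'I_n)
    (f : 'rV[R]_n -> R) : 'rV[R]_n -> R :=
  fun x => 'D_(delta_mx ord0 i) (f : 'rV[R]_n -> R^o) x.

Definition iter_partial (R : realType) (n : nat) (s : seq 'I_n)
    (f : 'rV[R]_n -> R) : 'rV[R]_n -> R :=
  foldr (@partial_deriv R n) f s.

(* 'D_v is total, so the existence of each derivative has to be required
   separately. *)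
Definition smooth (R : realType) (n : nat) (f : 'rV[R]_n -> R) : Prop :=
  forall s : seq 'I_n,
    continuous (iter_partial s f) /\
    forall (i : 'I_n) (x : 'rV[R]_n),
      derivable (iter_partial s f : 'rV[R]_n -> R^o) x (delta_mx ord0 i).

Definition gradient (R : realType) (n : nat) (f : 'rV[R]_n -> R)
    (x : 'rV[R]_n) : 'rV[R]_n :=
  \row_(i < n) partial_deriv i f x.

(* The library norm `|v| on row vectors is the sup norm. *)
Definition euclidean_norm (R : realType) (n : nat) (v : 'rV[R]_n) : R :=
  Num.sqrt (\sum_(i < n) v ord0 i ^+ 2).

(* X has law N(0, I_n), the n-fold product of N(0, 1): its coordinates are
   independent standard normal random variables. The product rule over all
   measurable boxes determines the law; taking some of the B i to be setT gives
   the marginals and the product rule for subfamilies. *)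
Definition standard_gaussian (R : realType) (n : nat) (d : measure_display)
    (T : measurableType d) (P : probability T R) (X : T -> 'rV[R]_n) : Prop :=
  (forall i : 'I_n, measurable_fun setT (fun t => X t ord0 i)) /\
  (forall B : 'I_n -> set R, (forall i, measurable (B i)) ->
    P [set t | forall i, B i (X t ord0 i)] =
    (\prod_(i < n) normal_prob 0 1 (B i))%E).

(* Main.v *)
Require Import Defs.
From mathcomp Require Import all_boot all_order all_algebra.
From mathcomp Require Import all_classical all_reals all_analysis.
From mathcomp Require Import measurable_realfun ring lra.

(* Take f(x) = x_k^2 / 2 for a single coordinate k. Then e^f and
   e^(|grad f|^2 / 2) are both e^(x_k^2 / 2), which exactly cancels the Gaussian
   density. Up to the factor 1 / sqrt(2 pi), the first expectation is therefore
   the Lebesgue measure of the line, and the second is the integral of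
   (1 + |x|)^(- c), which converges for c > 1. *)

Set Implicit Arguments.
Unset Strict Implicit.
Unset Printing Implicit Defensive.

Import Order.TTheory GRing.Theory Num.Theory.
Import numFieldNormedType.Exports.

Local Open Scope classical_set_scope.
Local Open Scope ring_scope.

(** * Differential calculus of quadratics in one coordinate *)

Lemma is_derive_coord (R : realType) (n : nat) (k : 'I_n) (x v : 'rV[R]_n) :
  is_derive x v (fun y : 'rV[R]_n => y ord0 k : R^o) (v ord0 k).
Proof.
(* A coordinate is linear, so the difference quotient is constant for [h != 0]. *)
have H : h^-1 *: ((h *: v + x) ord0 k - x ord0 k : R^o) @[h --> 0^'] --> v ord0 k.
  apply: (@cvg_trans _ ((fun=> v ord0 k : R^o) @ 0^')); last exact: cvg_cst.
  apply: near_eq_cvg; near=> h.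
  rewrite !mxE addrK scalerA mulVf ?scale1r//.
  by near: h; exact: nbhs_dnbhs_neq.
split; first by apply/cvg_ex; exists (v ord0 k).
exact: cvg_lim H.
Unshelve. all: by end_near. Qed.

(** The witness is the case [a = 2^-1], [b = c = 0]. General coefficients make the family stable
    under every partial derivative, so smoothness follows by induction on the list of
    derivatives. *)
Definition coord_quadratic (R : realType) (n : nat) (k : 'I_n) (a b c : R)
    (x : 'rV[R]_n) : R :=
  a * x ord0 k ^+ 2 + b * x ord0 k + c.

Lemma is_derive_coord_quadratic (R : realType) (n : nat) (k : 'I_n) (a b c : R)
    (x v : 'rV[R]_n) :
  is_derive x v (coord_quadratic k a b c : 'rV[R]_n -> R^o)
    ((a * 2 * x ord0 k + b) * v ord0 k).
Proof.
pose p : 'rV[R]_n -> R^o := fun y => y ord0 k.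
have dp : is_derive x v p (v ord0 k) := is_derive_coord k x v.
(* Written as a combination of functions, the quadratic has its derivative inferred from the
   instances for sums, scalings and powers. *)
have -> : coord_quadratic k a b c =
    ((a \*: (p ^+ 2)) + (b \*: p) + cst c : 'rV[R]_n -> R^o).
  by [].
apply: is_derive_eq.
rewrite /= addr0 /p expr1 /GRing.scale/=; ring.
Qed.

Lemma partial_deriv_coord_quadratic (R : realType) (n : nat) (k i : 'I_n)
    (a b c : R) :
  partial_deriv i (coord_quadratic k a b c) =
  coord_quadratic k 0 (a * 2 * (k == i)%:R) (b * (k == i)%:R).
Proof.
apply/funext => x; rewrite /partial_deriv.
have [_ ->] := is_derive_coord_quadratic k a b c x (delta_mx ord0 i).
by rewrite /coord_quadratic mxE eqxx/=; ring.
Qed.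

Lemma smooth_coord_quadratic (R : realType) (n : nat) (k : 'I_n) (a b c : R) :
  smooth (coord_quadratic k a b c).
Proof.
move=> s.
have [a' [b' [c' ->]]] : exists a' b' c',
    iter_partial s (coord_quadratic k a b c) = coord_quadratic k a' b' c'.
  elim: s => [|i s [a' [b' [c' IH]]]]; first by exists a, b, c.
  rewrite /iter_partial /= -/(iter_partial s _) IH.
  by rewrite partial_deriv_coord_quadratic; eexists _, _, _.
split=> [x|i x]; last by have [] := is_derive_coord_quadratic k a' b' c' x
  (delta_mx ord0 i).
have cx : {for x, continuous (fun y : 'rV[R]_n => y ord0 k)}.
  exact: coord_continuous.
have cp : continuous (fun z : R => a' * z ^+ 2 + b' * z + c').
  move=> z; apply: (@cvgD _ R^o); last exact: cvg_cst.
  by apply: (@cvgD _ R^o); apply: cvgM;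
    [exact: cvg_cst|exact: sqr_continuous|exact: cvg_cst|exact: cvg_id].
exact: (continuous_comp cx (cp _)).
Qed.

Lemma gradient_half_sqr_coord (R : realType) (n : nat) (k : 'I_n)
    (x : 'rV[R]_n) :
  gradient (coord_quadratic k 2^-1 0 0) x = x ord0 k *: delta_mx ord0 k.
Proof.
apply/rowP => i; rewrite !mxE partial_deriv_coord_quadratic /coord_quadratic.
by rewrite eqxx/= [i == k]eq_sym mulVf ?pnatr_eq0//; ring.
Qed.

Lemma euclidean_norm_delta_mx (R : realType) (n : nat) (k : 'I_n) (a : R) :
  euclidean_norm (a *: delta_mx ord0 k) = `|a|.
Proof.
rewrite /euclidean_norm (bigD1 k)//= big1 => [|i ik].
  by rewrite !mxE !eqxx mulr1 addr0 sqrtr_sqr.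
by rewrite !mxE eqxx (negbTE ik) mulr0 expr0n.
Qed.

(** * Gaussian expectations as Lebesgue integrals *)

Lemma ge0_integral_normal_prob (R : realType) (m s : R) (f : R -> R) :
  measurable_fun [set: R] f -> (forall x, 0 <= f x) ->
  (\int[normal_prob m s]_x (f x)%:E =
   \int[lebesgue_measure]_x (f x * normal_pdf m s x)%:E)%E.
Proof.
move=> mf f0; have numu := normal_prob_dominates m s.
have mEf : measurable_fun [set: R] (EFin \o f) by
  exact/measurable_EFinP.
rewrite -(Radon_Nikodym_SigmaFinite.change_of_variables numu)//.
under [RHS]eq_integral do rewrite EFinM.
have mpdf : measurable_fun [set: R] (EFin \o normal_pdf m s).
  by apply/measurable_EFinP; exact: measurable_normal_pdf.
have iRN := Radon_Nikodym_SigmaFinite.f_integrable numu.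
apply: ae_eq_integral => //.
- by apply: emeasurable_funM => //; exact: measurable_int iRN.
- exact: emeasurable_funM.
(* The Radon-Nikodym derivative and [normal_pdf] both integrate to [normal_prob m s E] over each
   measurable [E], hence agree almost everywhere. *)
apply: ae_eqe_mul2l; apply: integral_ae_eq => // E _ mE.
by rewrite -Radon_Nikodym_SigmaFinite.f_integral.
Qed.

Lemma ge0_integral_standard_gaussian_coord (R : realType) (n : nat)
    (d : measure_display) (T : measurableType d) (P : probability T R)
    (X : T -> 'rV[R]_n) (k : 'I_n) (f : R -> R) :
  standard_gaussian P X ->
  measurable_fun [set: R] f -> (forall x, 0 <= f x) ->
  (\int[P]_t (f (X t ord0 k))%:E = \int[normal_prob 0 1]_x (f x)%:E)%E.
Proof.
move=> [mX PX] mf f0.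
have mEf : measurable_fun [set: R] (EFin \o f) by
  exact/measurable_EFinP.
(* Same sigma-algebra on R, but carrying the measure display used by
   [normal_prob]. *)
have mXk : measurable_fun setT (fun t => X t ord0 k : measurableTypeR R) :=
  mX k.
have <- := @ge0_integral_pushforward _ _ _ _ R _ mXk P setT _ measurableT mEf;
  last by move=> x _; rewrite lee_fin.
apply: eq_measure_integral => A mA _.
(* The box constrained only in direction [k] gives the marginal law: every other factor of the
   product is 1. *)
pose B i := if i == k then A else setT.
transitivity (P [set t | forall i, B i (X t ord0 i)]).
  congr (P _); apply/seteqP; split => t /=.
    by move=> At i; rewrite /B; case: eqP => // ->.
  by move=> /(_ k); rewrite /B eqxx.
rewrite PX => [|i]; last by rewrite /B; case: ifP.
rewrite (bigD1 k)//= /B eqxx big1 ?mule1// => i /negbTE ->.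
exact: probability_setT.
Qed.

Lemma expR_normal_pdf01 (R : realType) (x : R) :
  expR (2^-1 * x ^+ 2) * normal_pdf 0 1 x = normal_peak 1.
Proof.
rewrite normal_pdfE ?oner_eq0// mulrCA /normal_fun -expRD subr0 expr1n.
rewrite (_ : _ + _ = 0) ?expR0 ?mulr1//.
by rewrite mulNr mulrC subrr.
Qed.

(** * Convergence of the one-dimensional integral *)

Lemma integral_powR1D_lty (R : realType) (c : R) : 1 < c ->
  (\int[lebesgue_measure]_(x in `[0%R, +oo[) ((1 + x) `^ (- c))%:E < +oo)%E.
Proof.
move=> c1.
(* An antiderivative of the integrand on [x > -1], an open set containing the endpoint 0. It
   vanishes at infinity because [1 - c < 0], so the integral is the finite number [- F 0]. *)
pose F (x : R) := (1 - c)^-1 * (1 + x) `^ (1 - c).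
have dF (x : R) : -1 < x -> is_derive x 1 F ((1 + x) `^ (- c)).
  move=> x0; have x1 : 0 < 1 + x by lra.
  have H : is_derive x 1 ((fun y : R => y `^ (1 - c)) \o (fun y => 1 + y))
      ((1 - c) * (1 + x) `^ (- c)).
    have h1 := is_derive1_powR (1 - c) x1.
    have h2 : is_derive x 1 (fun y : R => 1 + y) 1.
      have := is_deriveD (is_derive_cst (1 : R) x 1) (is_derive_id x 1).
      by rewrite add0r.
    have := is_derive1_comp h1 h2.
    by rewrite mulr1 addrAC subrr add0r.
  have := is_deriveZ (1 - c)^-1 H.
  rewrite /GRing.scale/= mulrA mulVf ?mul1r//; lra.
have cf : {in `]-1, +oo[, continuous (fun x : R => (1 + x) `^ (- c))}.
  move=> x; rewrite in_itv/= andbT => x0; have x1 : 0 < 1 + x by lra.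
  apply: (continuous_comp (f := fun y : R => 1 + y)
    (g := fun z => z `^ (- c))).
    by apply: continuousD; [exact: cvg_cst|exact: cvg_id].
  apply: differentiable_continuous; apply/derivable1_diffP.
  by have [] := is_derive1_powR (- c) x1.
have cF (x : R) : -1 < x -> {for x, continuous F}.
  move=> x0; apply: differentiable_continuous; apply/derivable1_diffP.
  by have [] := dF x x0.
rewrite (@ge0_continuous_FTC2y _ _ F 0 0) ?ltry//.
- by move=> x x0; exact: powR_ge0.
- apply: continuous_in_subspaceT => x; rewrite inE/= in_itv/= andbT => x0.
  by apply: cf; rewrite in_itv/= andbT; lra.
- rewrite -(mulr0 (1 - c)^-1); apply: cvgM; first exact: cvg_cst.
  (* The limit of [(1 + x) ^ (1 - c)] at infinity is read as that of [z ^ (c - 1)] at [0+], with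
     [z = (1 + x)^-1] and positive exponent. *)
  have V0 : (1 + x)^-1 @[x --> +oo] --> (0 : R)^'+.
    have pos : \forall x \near +oo, (0 : R) < 1 + x.
      by near=> x; rewrite -ltrBlDl; near: x; exact: nbhs_pinfty_gt.
    have /(gtr0_cvgV0 pos) V : (1 : R) + x @[x --> +oo] --> +oo by
      exact: cvg_addrl.
    move=> A /V VA; apply: filterS2 pos VA => x x0 /=; apply.
    by rewrite invr_gt0.
  have c0 : 0 < c - 1 by lra.
  apply: cvg_trans; last first.
    exact: (cvg_comp (fun x : R => (1 + x)^-1) (fun z => z `^ (c - 1))
      V0 (powR_cvg0 c0)).
  apply: near_eq_cvg; near=> x; rewrite /= -powR_inv1; last first.
    by rewrite -lerBlDl; near: x; exact: nbhs_pinfty_ge.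
  by rewrite -powRrM; congr (_ `^ _); lra.
- by move=> x x0; have [] := dF x ltac:(lra).
- by apply: cvg_at_right_filter; apply: cF; lra.
- move=> x; rewrite in_itv/= andbT => x0; rewrite derive1E.
  by have [_ ->] := dF x ltac:(lra).
Unshelve. all: by end_near. Qed.

Lemma integralT_powR1D_norm_lty (R : realType) (c : R) : 1 < c ->
  (\int[lebesgue_measure]_x ((1 + `|x|) `^ (- c))%:E < +oo)%E.
Proof.
move=> c1; rewrite ge0_symfun_integralT.
- rewrite -set_itvcy (_ : integral _ _ _ =
      \int[lebesgue_measure]_(x in `[0%R, +oo[) ((1 + x) `^ (- c))%:E)%E.
    by rewrite lte_mul_pinfty// ?lee_fin// integral_powR1D_lty.
  apply: eq_integral => x; rewrite inE/= in_itv/= andbT => x0.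
  by rewrite ger0_norm.
- by move=> x; exact: powR_ge0.
- move=> x.
  apply: (continuous_comp (f := fun y : R => 1 + `|y|)
    (g := fun z => z `^ (- c))).
    by apply: continuousD; [exact: cvg_cst|exact: norm_continuous].
  apply: differentiable_continuous; apply/derivable1_diffP.
  by have [] := is_derive1_powR (- c) (ltr_wpDr (normr_ge0 x) ltr01).
- by move=> x /=; rewrite normrN.
Qed.

Theorem mainTheorem2 (R : realType) (n : nat) (hn : (1 <= n)%N)
    (d : measure_display) (T : measurableType d) (P : probability T R)
    (X : T -> 'rV[R]_n) (hX : standard_gaussian P X) :
  exists f : 'rV[R]_n -> R,
    smooth f /\
    ('E_P[fun t => expR (f (X t))] = +oo)%E /\
    forall c : R, 1 < c ->
      ('E_P[fun t =>
              (expR (2^-1 * euclidean_norm (gradient f (X t)) ^+ 2) *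
               (1 + euclidean_norm (gradient f (X t))) `^ (- c))%R] < +oo)%E.
Proof.
(* [hn] is also the proof that index 0 is below [n]; this is where [n >= 1] enters. *)
pose k : 'I_n := Ordinal hn.
exists (coord_quadratic k 2^-1 0 0); split; first exact: smooth_coord_quadratic.
have mexp : measurable_fun [set: R] (fun x => expR (2^-1 * x ^+ 2)).
  by apply: measurableT_comp => //; apply: measurable_funM => //;
    exact: measurable_funX.
have peak0 : 0 < normal_peak (1 : R) by rewrite normal_peak_gt0 ?oner_eq0.
split=> [|c c1]; rewrite unlock.
  under eq_integral do rewrite /coord_quadratic mul0r !addr0.
  rewrite (ge0_integral_standard_gaussian_coord k hX mexp)//.
  rewrite ge0_integral_normal_prob//.
  under eq_integral do rewrite expR_normal_pdf01.
  (* What remains is the positive constant [normal_peak 1] times the infinite length of the line. *)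
  rewrite integral_cst//= -set_itvNyy lebesgue_measure_itv/=.
  by rewrite gt0_muley// lte_fin.
(* The gradient has norm [|x_k|], so this integrand too depends on [x_k] alone and the
   one-dimensional reduction applies to [g]. *)
under eq_integral do
  rewrite gradient_half_sqr_coord euclidean_norm_delta_mx real_normK ?num_real//.
pose g (x : R) := expR (2^-1 * x ^+ 2) * (1 + `|x|) `^ (- c).
have mpow : measurable_fun [set: R] (fun x => (1 + `|x|) `^ (- c)).
  apply: (measurableT_comp (measurable_powR _)) => //.
  by apply: measurable_funD => //; exact: measurableT_comp.
have mg : measurable_fun [set: R] g by exact: measurable_funM.
have g0 x : 0 <= g x by rewrite mulr_ge0 ?expR_ge0 ?powR_ge0.
rewrite (ge0_integral_standard_gaussian_coord k hX mg g0).
rewrite ge0_integral_normal_prob//.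
(* The exponential cancels the density up to the factor [normal_peak 1], leaving only the power of
   [1 + |x|]. *)
under eq_integral do rewrite /g mulrAC expR_normal_pdf01 EFinM.
rewrite ge0_integralZl//=.
- by rewrite lte_mul_pinfty ?lee_fin ?ltW// integralT_powR1D_norm_lty.
- exact/measurable_EFinP.
- by rewrite lee_fin ltW.
Qed.
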